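(* Let $\mathscr{H},\mathscr{K}$ be Hilbert spaces and let $m<M$ be real numbers. Let $A_1,\ldots,A_n\in\mathbb{B}(\mathscr{H})$ be self-adjoint operators with spectra in $[m,M]$, and let $\Phi_1,\ldots,\Phi_n:\mathbb{B}(\mathscr{H})\to\mathbb{B}(\mathscr{K})$ be positive linear maps with $\sum_{i=1}^n\Phi_i(\mathbf{1}_{\mathscr{H}})=\mathbf{1}_{\mathscr{K}}$. Let $f:[m,M]\to(0,\infty)$ be a log-convex function. Then $$f\left((M+m)\mathbf{1}_{\mathscr{K}}-\sum_{i=1}^n\Phi_i(A_i)\right)\le [f(m)]^{\frac{\sum_{i=1}^n\Phi_i(A_i)-m\mathbf{1}_{\mathscr{K}}}{M-m}}\,[f(M)]^{\frac{M\mathbf{1}_{\mathscr{K}}-\sum_{i=1}^n\Phi_i(A_i)}{M-m}}\le \left(f(M)+f(m)\right)\mathbf{1}_{\mathscr{K}}-\sum_{i=1}^n\Phi_i(f(A_i)).$$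
   Context: $\mathbb{B}(\mathscr{H})$ is the $C^*$-algebra of all bounded linear operators on the Hilbert space $\mathscr{H}$, and $\mathbf{1}_{\mathscr{H}}$ is the identity operator. $A\ge 0$ means $\langle Ax,x\rangle\ge 0$ for all $x$; for self-adjoint $A,B$, $A\le B$ means $B-A\ge 0$. A linear map $\Phi:\mathbb{B}(\mathscr{H})\to\mathbb{B}(\mathscr{K})$ is positive if $\Phi(A)\ge 0$ whenever $A\ge 0$. A positive function $f$ on an interval is log-convex if $\log f$ is convex. For a self-adjoint operator $A$ with spectrum in $[m,M]$, $f(A)$ is defined by the functional calculus (the Borel functional calculus if $f$ is not continuous at an endpoint); for a scalar $c>0$ and a self-adjoint operator $T$, $c^{T}:=\exp((\log c)\,T)$. The two operator powers in the claim commute, both being functions of $\sum_{i}\Phi_i(A_i)$. *)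

(* Defs.v *)
From HB Require Import structures.
From mathcomp Require Import all_boot all_order all_algebra.
From mathcomp Require Import complex.
From mathcomp Require Import all_classical all_reals all_analysis.

Set Implicit Arguments.
Unset Strict Implicit.
Unset Printing Implicit Defensive.

Import Order.TTheory GRing.Theory Num.Theory.
Import numFieldNormedType.Exports.

Local Open Scope classical_set_scope.
Local Open Scope complex_scope.
Local Open Scope ring_scope.

(* Complex Hilbert spaces. The norm of a normed module over R[i] is R[i]-valued,
   and 0 <= z in R[i] means that z is real and nonnegative. The form is linear
   in its first argument and conjugate-linear in its second. *)
HB.mixin Record isHilbert (R : realType) H of CompleteNormedModule R[i] H := {
  inner : {dot H for (@Num.conj R[i])} ;
  innerE : forall x : H, inner x x = `|x| ^+ 2
}.

#[short(type="hilbertType")]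
HB.structure Definition Hilbert (R : realType) :=
  {H of isHilbert R H & CompleteNormedModule R[i] H}.

Notation "''[' x , y ]" := (@inner _ _ x y)
  (format "''[' x ,  y ]") : ring_scope.

Section BoundedOperators.
Context {R : realType}.
Implicit Types H K L : hilbertType R.

Definition bounded_linear H K : {pred H -> K} := fun T : H -> K =>
  `[< linear T /\ exists c : R[i], forall x, `|T x| <= c * `|x| >].

Lemma bounded_linear_submod_closed H K : submod_closed (@bounded_linear H K).
Proof.
split.
  apply/asboolP; split; first by move=> a x y /=; rewrite scaler0 addr0.
  by exists 0 => x; rewrite normr0 mul0r.
move=> a S T /asboolP[linS [c Sc]] /asboolP[linT [d Td]]; apply/asboolP; split.
  move=> b x y; rewrite /= !addrfctE !scalrfctE linS linT.
  by rewrite !scalerDr !scalerA addrACA (mulrC a b).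
exists (`|a| * c + d) => x; rewrite addrfctE scalrfctE.
rewrite (le_trans (ler_normD _ _))// mulrDl lerD// normrZ -mulrA.
exact: ler_wpM2l.
Qed.

HB.instance Definition _ H K := GRing.isSubmodClosed.Build R[i] (H -> K)
  (@bounded_linear H K) (@bounded_linear_submod_closed H K).

Record bop H K := Bop {
  bop_fun :> H -> K ;
  bop_subproof : bop_fun \in @bounded_linear H K
}.

HB.instance Definition _ H K := [isSub for @bop_fun H K].
HB.instance Definition _ H K := [Choice of bop H K by <:].
HB.instance Definition _ H K := [SubChoice_isSubLmodule of bop H K by <:].

Lemma bopP H K (T : bop H K) :
  linear T /\ exists c : R[i], forall x, `|T x| <= c * `|x|.
Proof. exact/asboolP/bop_subproof. Qed.

Lemma id_bounded_linear H : (@id H) \in @bounded_linear H H.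
Proof. by apply/asboolP; split=> //; exists 1 => x; rewrite mul1r. Qed.

Lemma comp_bounded_linear H K L (S : bop K L) (T : bop H K) :
  S \o T \in @bounded_linear H L.
Proof.
have [linS [c Sc]] := bopP S; have [linT [d Td]] := bopP T.
apply/asboolP; split; first by move=> a x y /=; rewrite linT linS.
exists (`|c| * d) => x; rewrite -mulrA (le_trans (Sc _))//.
have cS : c * `|T x| <= `|c| * `|T x|.
  have [->|Tx0] := eqVneq (T x) 0; first by rewrite normr0 !mulr0.
  have cT0 : 0 <= c * `|T x| by rewrite (le_trans _ (Sc _)).
  by rewrite -[leLHS]ger0_norm// normrM normr_id.
exact: le_trans cS (ler_wpM2l _ _).
Qed.

Definition bop_id H : bop H H := Bop (id_bounded_linear H).
Definition bop_comp H K L (S : bop K L) (T : bop H K) : bop H L :=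
  Bop (comp_bounded_linear S T).

Lemma bopPext H K (S T : bop H K) : S =1 T -> S = T.
Proof. by move=> ST; apply/val_inj/funext. Qed.

Fact bop_compA H : associative (@bop_comp H H H).
Proof. by move=> S T U; exact: bopPext. Qed.
Fact bop_comp1l H : left_id (bop_id H) (@bop_comp H H H).
Proof. by move=> S; exact: bopPext. Qed.
Fact bop_comp1r H : right_id (bop_id H) (@bop_comp H H H).
Proof. by move=> S; exact: bopPext. Qed.
Fact bop_compDl H : left_distributive (@bop_comp H H H) +%R.
Proof. by move=> S T U; exact: bopPext. Qed.
Fact bop_compDr H : right_distributive (@bop_comp H H H) +%R.
Proof.
move=> S T U; apply: bopPext => x /=; rewrite !addrfctE.
by have := (bopP S).1 1 (T x) (U x); rewrite !scale1r.
Qed.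

HB.instance Definition _ H := GRing.Zmodule_isPzRing.Build (bop H H)
  (@bop_compA H) (@bop_comp1l H) (@bop_comp1r H) (@bop_compDl H) (@bop_compDr H).

End BoundedOperators.

Notation "''B' ( H )" := (bop H H) (format "''B' ( H )") : type_scope.

Section OperatorNotions.
Context {R : realType}.
Implicit Types H K : hilbertType R.

Definition selfadjoint H (A : 'B(H)) : Prop :=
  forall x y : H, '[A x, y] = '[x, A y].

Definition op_ge0 H (A : 'B(H)) : Prop := forall x : H, 0 <= '[A x, x].

Definition op_le H (A B : 'B(H)) : Prop := op_ge0 (B - A).

Definition positive_map H K (Phi : 'B(H) -> 'B(K)) : Prop :=
  forall A : 'B(H), op_ge0 A -> op_ge0 (Phi A).

Definition spectrum H (A : 'B(H)) : set R[i] :=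
  [set z | ~ exists B : 'B(H),
    (A - z *: (1 : 'B(H))) * B = 1 /\ B * (A - z *: (1 : 'B(H))) = 1].

Definition log_convex (D : set R) (f : R -> R) : Prop :=
  (forall t, D t -> 0 < f t) /\
  convex_function (D : set R^o) (fun t : R^o => ln (f t)).

(* The scalar spectral measure <E(.) x, x> of a self-adjoint operator A with
   spectrum in [m, M]: the only finite Borel measure concentrated on [m, M]
   whose moments are the <A^k x, x>. *)
Definition spectral_measure (m M : R) H (A : 'B(H)) (x : H)
    (mu : {finite_measure set (measurableTypeR R) -> \bar R}) : Prop :=
  mu (~` `[m, M]) = 0%E /\
  forall k : nat, '[(A ^+ k) x, x] = (\int[mu]_(t in `[m, M]) (t ^+ k))%:C.

(* B is the integral of f against the spectral measure of A. As the scalars are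
   complex, the quadratic form of B determines B. *)
Definition is_fcalc (m M : R) (f : R -> R) H (A B : 'B(H)) : Prop :=
  forall x : H, exists mu : {finite_measure set (measurableTypeR R) -> \bar R},
    [/\ spectral_measure m M A x mu,
        mu.-integrable `[m, M] (EFin \o f) &
        '[B x, x] = (\int[mu]_(t in `[m, M]) f t)%:C].

(* Borel functional calculus on [m, M]; only the values of f on [m, M] matter.
   For A self-adjoint with spectrum in [m, M] and f bounded and Borel on
   [m, M], the operator exists, so that the default value 0 is not used. *)
Definition fcalc (m M : R) (f : R -> R) H (A : 'B(H)) : 'B(H) :=
  xget 0 [set B | is_fcalc m M f A B].

(* The exponential series converges absolutely in operator norm, so that its
   sum can be computed pointwise. *)
Definition op_exp H (T : 'B(H)) : 'B(H) :=
  xget 0 [set B : 'B(H) | forall x : H,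
    series (fun k : nat => (k`!%:R^-1 : R[i]) *: (T ^+ k) x) @ \oo --> B x].

Definition op_power H (c : R) (T : 'B(H)) : 'B(H) := op_exp ((ln c)%:C *: T).

End OperatorNotions.

(* Main.v *)
(* Write [F = (S - m) / (M - m)], [a = ln f(m)] and [b = ln f(M)], where
   [S = sum_i Phi_i(A_i)]; since [m <= A_i <= M] we have [0 <= F <= 1], and the
   middle operator is [exp(a F + b (1 - F))].
   On the left, log-convexity gives [f(t) <= exp(p + q t)] on [m, M]; integrate
   against the spectral measure of [M + m - S] and recognize the right-hand side
   from the moments, by dominated convergence.
   On the right, [X^(k+1) <= X] for [0 <= X <= 1] gives
   [exp(a F + b (1 - F)) <= f(m) F + f(M) (1 - F)] term by term in the power
   series, while [f] lies below its chord, so that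
   [sum_i Phi_i(f(A_i)) <= f(m) (1 - F) + f(M) F]. The two bounds add up to
   [f(m) + f(M)].
   The existence of the functional calculus plays no role: its default value
   [0] would satisfy both bounds. *)
Require Import Defs.
From HB Require Import structures.
From mathcomp Require Import all_boot all_order all_algebra.
From mathcomp Require Import complex.
From mathcomp Require Import all_classical all_reals all_analysis.
From mathcomp Require Import measurable_realfun ring lra.

Set Implicit Arguments.
Unset Strict Implicit.
Unset Printing Implicit Defensive.

Import Order.TTheory GRing.Theory Num.Theory.
Import numFieldNormedType.Exports.

Local Open Scope classical_set_scope.
Local Open Scope complex_scope.
Local Open Scope ring_scope.

(** * Real-valued norms and convergence in modules over [R[i]] *)

Section RealNorm.
Context {R : realType} {V : normedModType R[i]}.
Implicit Types (x y : V) (u : V^nat).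

Definition rnorm x : R := complex.Re `|x|.

Lemma rnormE x : `|x| = (rnorm x)%:C.
Proof. by rewrite RRe_real ?normr_real. Qed.

Lemma rnorm_ge0 x : 0 <= rnorm x.
Proof. by rewrite -ler0c -rnormE. Qed.

Lemma rnorm0 : rnorm (0 : V) = 0.
Proof. by rewrite /rnorm normr0. Qed.

Lemma ler_rnormD x y : rnorm (x + y) <= rnorm x + rnorm y.
Proof. by rewrite -lecR rmorphD/= -!rnormE ler_normD. Qed.

Lemma rnormB x y : rnorm (x - y) = rnorm (y - x).
Proof. by rewrite /rnorm distrC. Qed.

Lemma normc_real (c : R) : `|c%:C| = `|c|%:C.
Proof. by rewrite normc_def/= expr0n addr0 sqrtr_sqr. Qed.

Lemma rnormZ (c : R) x : rnorm (c%:C *: x) = `|c| * rnorm x.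
Proof. by rewrite /rnorm normrZ rnormE normc_real -rmorphM. Qed.

Lemma ler_rnorm_sum (I : Type) (r : seq I) (P : pred I) (F : I -> V) :
  rnorm (\sum_(i <- r | P i) F i) <= \sum_(i <- r | P i) rnorm (F i).
Proof.
elim/big_rec2: _ => [|i a b _ ba]; first by rewrite rnorm0.
by rewrite (le_trans (ler_rnormD _ _))// lerD2l.
Qed.

(** Positivity in [R[i]] forces the imaginary part to vanish; this lets every complex epsilon in a
    limit be replaced by a real one. *)
Lemma gt0_realC (e : R[i]) : 0 < e -> 0 < complex.Re e /\ e = (complex.Re e)%:C.
Proof.
move=> e0; have eE : (complex.Re e)%:C = e by rewrite RRe_real// gtr0_real.
by split=> //; rewrite -ltcR eE.
Qed.

Lemma cvg_rnormP u l : u @ \oo --> l <-> rnorm (u n - l) @[n --> \oo] --> (0 : R).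
Proof.
split=> [/cvgrPdist_le ul|/cvgrPdist_le ul]; apply/cvgrPdist_le => e e0.
  have eC0 : 0 < e%:C by rewrite ltcR.
  apply: filterS (ul _ eC0) => n.
  by rewrite sub0r normrN rnormE lecR rnormB ger0_norm ?rnorm_ge0.
have [e'0 ->] := gt0_realC e0; apply: filterS (ul _ e'0) => n.
by rewrite sub0r normrN rnormE lecR rnormB ger0_norm ?rnorm_ge0.
Qed.

Lemma rnorm_lim_le u l (c : R) :
  u @ \oo --> l -> (forall n, rnorm (u n) <= c) -> rnorm l <= c.
Proof.
move=> /cvg_rnormP ul uc.
suff: rnorm l - c <= 0 by rewrite subr_le0.
apply: cvgr_to_ge ul _; apply: nearW => n.
rewrite lerBlDr -[X in rnorm X](subrK (u n)) (le_trans (ler_rnormD _ _))//.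
by rewrite rnormB lerD.
Qed.

End RealNorm.

(** Comparison test: the Cauchy criterion passes from the real majorant to [u], and completeness of
    [V] concludes. *)
Lemma cvg_series_rnorm (R : realType) (V : completeNormedModType R[i])
    (u : V^nat) (v : R^nat) :
  (forall k, rnorm (u k) <= v k) -> cvgn (series v) -> cvgn (series u).
Proof.
move=> uv /cauchy_cvgP/cauchy_seriesP cv; apply/cauchy_cvgP/cauchy_seriesP => e.
move=> /gt0_realC[e0 ->]; apply: filterS (cv _ e0) => -[m n] /=.
rewrite rnormE ltcR; apply: le_lt_trans; apply: le_trans (ler_rnorm_sum _ _ _) _.
by rewrite (le_trans _ (ler_norm _))// ler_sum.
Qed.

(** * Inner products: Cauchy-Schwarz and continuity *)

Section InnerProduct.
Context {R : realType} {H : hilbertType R}.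
Implicit Types x y z : H.

Lemma inner_conj x y : '[x, y] = Num.conj '[y, x].
Proof. by rewrite hermC expr0 mul1r. Qed.
Lemma innerDl x y z : '[x + y, z] = '[x, z] + '[y, z].
Proof. exact: linearDl. Qed.
Lemma innerDr x y z : '[z, x + y] = '[z, x] + '[z, y].
Proof. exact: linearDr. Qed.
Lemma innerBl x y z : '[x - y, z] = '[x, z] - '[y, z].
Proof. exact: linearBl. Qed.
Lemma innerBr x y z : '[z, x - y] = '[z, x] - '[z, y].
Proof. exact: linearBr. Qed.
Lemma innerZl a y z : '[a *: y, z] = a * '[y, z].
Proof. exact: linearZl_LR. Qed.
Lemma innerZr a y z : '[z, a *: y] = Num.conj a * '[z, y].
Proof. exact: linearZr_LR. Qed.

Lemma inner_suml (I : Type) (r : seq I) (P : pred I) (F : I -> H) x :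
  '[\sum_(i <- r | P i) F i, x] = \sum_(i <- r | P i) '[F i, x].
Proof.
by elim/big_rec2: _ => [|i a b _ <-]; [exact: linear0l|rewrite innerDl].
Qed.

Lemma inner_ge0 x : 0 <= '[x, x].
Proof. by rewrite innerE exprn_ge0. Qed.

Lemma innerxx x : '[x, x] = (rnorm x ^+ 2)%:C.
Proof. by rewrite innerE rnormE -rmorphXn. Qed.

(** Cauchy-Schwarz, from the nonnegative square norm of [x] minus its projection on the line of
    [y]. *)
Lemma inner_norm_le x y : `|'[x, y]| <= (rnorm x * rnorm y)%:C.
Proof.
have [->|y0] := eqVneq y 0; first by rewrite linear0r normr0 rnorm0 mulr0.
have ny0 : 0 < rnorm y by rewrite -ltcR -rnormE normr_gt0.
set a := '[x, y].
have yy0 : '[y, y] != 0 by rewrite innerxx fmorph_eq0 expf_neq0// gt_eqF.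
have cyy : Num.conj '[y, y] = '[y, y] by rewrite -inner_conj.
have : 0 <= '[x - (a / '[y, y]) *: y, x - (a / '[y, y]) *: y] by exact: inner_ge0.
rewrite innerBl !innerBr !innerZl !innerZr (inner_conj y x) -/a rmorphM.
rewrite fmorphV/= cyy.
have -> : '[x, x] - Num.conj a / '[y, y] * a - (a / '[y, y] * Num.conj a
    - a / '[y, y] * (Num.conj a / '[y, y] * '[y, y])) =
    '[x, x] - (a * Num.conj a) / '[y, y] by field.
rewrite -normCK subr_ge0 ler_pdivrMr ?innerxx ?ltcR ?exprn_gt0//.
rewrite -rmorphM/= -exprMn rmorphXn/= ler_sqr//.
by rewrite nnegrE ler0c mulr_ge0 ?rnorm_ge0.
Qed.

Lemma inner_lim (u : H^nat) l x : u @ \oo --> l ->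
  complex.Re '[u n, x] @[n --> \oo] --> complex.Re '[l, x].
Proof.
move=> /cvg_rnormP ul; apply/subr_cvg0.
have u0 : rnorm (u n - l) * rnorm x @[n --> \oo] --> (0 : R).
  by rewrite -[0](mul0r (rnorm x)); apply: cvgMl.
apply: norm_cvg0; apply: squeeze_cvgr (cvg_cst 0) u0; apply: nearW => n.
rewrite normr_ge0/= -lecR; apply: le_trans (inner_norm_le _ _).
by rewrite innerBl -raddfB normc_ge_Re.
Qed.

End InnerProduct.

(** * Finite Cauchy products: triangles and squares of indices *)

Lemma sum_triangle (V : nmodType) (F : nat -> nat -> V) (N : nat) :
  \sum_(0 <= k < N) \sum_(0 <= i < k.+1) F i (k - i)%N =
  \sum_(0 <= i < N) \sum_(0 <= j < N | (i + j < N)%N) F i j.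
Proof.
transitivity (\sum_(0 <= k < N) \sum_(0 <= i < N | (i <= k)%N) F i (k - i)%N).
  by apply: eq_big_nat => k /andP[_ kN]; rewrite (big_nat_widen _ _ N).
rewrite (exchange_big_dep_nat xpredT)//=; apply: eq_big_nat => i /andP[_ iN].
rewrite (_ : \sum_(0 <= k < N | _) _ = \sum_(0 + i <= k < N) F i (k - i)%N);
  last first.
  by rewrite add0n [RHS](big_nat_widenl i 0%N).
rewrite big_addn.
rewrite (big_nat_widen _ _ N) ?leq_subr//.
by apply: eq_big => [j|j _]; rewrite ?addnK// ltn_subRL addnC.
Qed.

(** A product of two partial sums is a sum over a square; the antidiagonals below [N] form the
    partial sum of the Cauchy product, and the remaining corner is the error. *)
Lemma sum_square_split (V : nmodType) (F : nat -> nat -> V) (N : nat) :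
  \sum_(0 <= i < N) \sum_(0 <= j < N) F i j =
  \sum_(0 <= k < N) \sum_(0 <= i < k.+1) F i (k - i)%N +
  \sum_(0 <= i < N) \sum_(0 <= j < N | (N <= i + j)%N) F i j.
Proof.
rewrite sum_triangle -big_split/=; apply: eq_bigr => i _.
rewrite (bigID (fun j => (i + j < N)%N))/=; congr (_ + _).
by apply: eq_bigl => j; rewrite -leqNgt.
Qed.

(** * The real exponential series *)

Section RealExponential.
Context {R : realType}.
Implicit Types a b d : R.

Lemma series_exp_coeffE d N :
  series (exp_coeff d) N = \sum_(0 <= k < N) d ^+ k / k`!%:R.
Proof. by []. Qed.

Lemma cvg_series_exp_coeff d : series (exp_coeff d) @ \oo --> expR d.
Proof. exact: is_cvg_series_exp_coeff. Qed.

Lemma series_exp_coeff_le d N : 0 <= d -> series (exp_coeff d) N <= expR d.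
Proof.
move=> d0; apply: (@cvgr_to_ge _ _ _ _ (series (exp_coeff d)) _ _
  (@cvg_series_exp_coeff d)).
near=> n; have Nn : (N <= n)%N by near: n; exact: nbhs_infty_ge.
rewrite !series_exp_coeffE (big_cat_nat _ Nn)//= lerDl sumr_ge0// => k _.
by rewrite divr_ge0// exprn_ge0.
Unshelve. all: by end_near. Qed.

Lemma exp_coeff_convolution d1 d2 k :
  \sum_(0 <= i < k.+1) (i`!%:R^-1 * (k - i)`!%:R^-1) * (d1 ^+ i * d2 ^+ (k - i))
  = (d1 + d2) ^+ k / k`!%:R.
Proof.
rewrite addrC exprDn big_mkord mulr_suml; apply: eq_bigr => i _.
have ik : (i <= k)%N by rewrite -ltnS.
have /(congr1 (fun n : nat => n%:R : R)) := bin_fact ik; rewrite !natrM => Ck.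
rewrite -mulr_natr -Ck; field.
have := fact_gt0 i; have := fact_gt0 (k - i).
rewrite !pnatr_eq0 -!lt0n => -> ->.
by rewrite bin_gt0.
Qed.

(** The corner is exactly the product of the two partial sums minus the partial sum for [d1 + d2],
    and both have limit [expR (d1 + d2)]. *)
Lemma exp_tail_cvg0 d1 d2 :
  \sum_(0 <= i < N) \sum_(0 <= j < N | (N <= i + j)%N)
    (i`!%:R^-1 * j`!%:R^-1) * (d1 ^+ i * d2 ^+ j) @[N --> \oo] --> (0 : R).
Proof.
rewrite (_ : (fun N => _) = fun N => series (exp_coeff d1) N *
    series (exp_coeff d2) N - series (exp_coeff (d1 + d2)) N).
  rewrite -[0](subrr (expR (d1 + d2))) {1}expRD.
  exact: (cvgB (cvgM (@cvg_series_exp_coeff d1) (@cvg_series_exp_coeff d2))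
    (@cvg_series_exp_coeff (d1 + d2))).
apply/funext => N; rewrite !series_exp_coeffE.
have -> : \sum_(0 <= k < N) (d1 + d2) ^+ k / k`!%:R = \sum_(0 <= k < N)
    \sum_(0 <= i < k.+1) (i`!%:R^-1 * (k - i)`!%:R^-1) * (d1 ^+ i * d2 ^+ (k - i)).
  by apply: eq_bigr => k _; rewrite exp_coeff_convolution.
have -> : (\sum_(0 <= k < N) d1 ^+ k / k`!%:R) *
    (\sum_(0 <= k < N) d2 ^+ k / k`!%:R) =
    \sum_(0 <= i < N) \sum_(0 <= j < N)
      (i`!%:R^-1 * j`!%:R^-1) * (d1 ^+ i * d2 ^+ j).
  rewrite mulr_suml; apply: eq_bigr => i _; rewrite mulr_sumr.
  by apply: eq_bigr => j _; rewrite mulrACA mulrC.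
by rewrite (sum_square_split (fun i j => (i`!%:R^-1 * j`!%:R^-1) *
  (d1 ^+ i * d2 ^+ j))) addrC addKr.
Qed.

End RealExponential.

(** * Operator algebra and the operator exponential *)

Section OperatorExponential.
Context {R : realType} {H : hilbertType R}.
Implicit Types (S T U V : 'B(H)) (x y : H) (d : R).

Lemma bopDE S T x : (S + T) x = S x + T x. Proof. by []. Qed.
Lemma bopNE T x : (- T) x = - T x. Proof. by []. Qed.
Lemma bopZE a T x : (a *: T) x = a *: T x. Proof. by []. Qed.
Lemma bopME S T x : (S * T) x = S (T x). Proof. by []. Qed.

Lemma bop_sumE (I : Type) (r : seq I) (P : pred I) (F : I -> 'B(H)) x :
  (\sum_(i <- r | P i) F i) x = \sum_(i <- r | P i) F i x.
Proof. by elim/big_rec2: _ => // i a T _ <-. Qed.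

Lemma bop_linP T a x y : T (a *: x + y) = a *: T x + T y.
Proof. by have [lT _] := bopP T; rewrite lT. Qed.

Lemma bop_lin0 T : T 0 = 0.
Proof. by have := bop_linP T (-1) 0 0; rewrite scaler0 addr0 scaleN1r addNr. Qed.

Lemma bop_linD T x y : T (x + y) = T x + T y.
Proof. by have := bop_linP T 1 x y; rewrite !scale1r. Qed.

Lemma bop_linZ T a x : T (a *: x) = a *: T x.
Proof. by have := bop_linP T a x 0; rewrite bop_lin0 !addr0. Qed.

Lemma bop_linN T x : T (- x) = - T x.
Proof. by rewrite -scaleN1r bop_linZ scaleN1r. Qed.

Lemma bop_linB T x y : T (x - y) = T x - T y.
Proof. by rewrite bop_linD bop_linN. Qed.

Lemma bop_scaleAl a S T : a *: (S * T) = (a *: S) * T.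
Proof. exact: bopPext. Qed.

Lemma bop_scaleAr a S T : a *: (S * T) = S * (a *: T).
Proof. by apply: bopPext => x; rewrite bopZE !bopME bopZE bop_linZ. Qed.

Lemma bop_commZ (a b : R[i]) S T : GRing.comm S T ->
  GRing.comm (a *: S) (b *: T).
Proof.
move=> ST; rewrite /GRing.comm -!bop_scaleAl -!bop_scaleAr ST !scalerA.
by rewrite [a * b]mulrC.
Qed.

Definition bop_bound T d := 0 <= d /\ forall x, rnorm (T x) <= d * rnorm x.

Lemma bop_boundP T : exists d, bop_bound T d.
Proof.
have [_ [c Tc]] := bopP T; exists (complex.Re `|c|); split.
  by rewrite -ler0c RRe_real ?normr_real.
move=> x; rewrite -lecR rmorphM/= -!rnormE.
have := Tc x; have [->|x0 cx] := eqVneq x 0.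
  by rewrite bop_lin0 !normr0 !mulr0.
have cx0 : 0 <= c * `|x| by exact: le_trans cx.
by rewrite (le_trans cx)// -[leLHS]ger0_norm// normrM normr_id.
Qed.

Lemma bop_boundX T d k : bop_bound T d -> bop_bound (T ^+ k) (d ^+ k).
Proof.
move=> [d0 Td]; split=> [|x]; first exact: exprn_ge0.
elim: k => [|k IH]; first by rewrite !expr0 mul1r.
by rewrite !exprS bopME (le_trans (Td _))// -mulrA ler_wpM2l.
Qed.

Definition exp_partial T N : 'B(H) :=
  \sum_(0 <= k < N) (k`!%:R^-1 : R[i]) *: T ^+ k.

Lemma factV_real k : (k`!%:R^-1 : R[i]) = (k`!%:R^-1 : R)%:C.
Proof. by rewrite fmorphV rmorph_nat. Qed.

Lemma exp_partialE T N x :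
  series (fun k : nat => (k`!%:R^-1 : R[i]) *: (T ^+ k) x) N = exp_partial T N x.
Proof. by rewrite /exp_partial bop_sumE. Qed.

Lemma exp_term_le T d x k : bop_bound T d ->
  rnorm ((k`!%:R^-1 : R[i]) *: (T ^+ k) x) <= exp_coeff d k * rnorm x.
Proof.
move=> /(bop_boundX k)[_ Tk]; rewrite factV_real rnormZ ger0_norm ?invr_ge0//.
by rewrite /exp_coeff/= mulrAC mulrC ler_wpM2r ?invr_ge0.
Qed.

Lemma exp_partial_bound T d N : bop_bound T d ->
  bop_bound (exp_partial T N) (expR d).
Proof.
move=> Td; split=> [|x]; first exact: expR_ge0.
rewrite -exp_partialE (le_trans (ler_rnorm_sum _ _ _))//.
rewrite (le_trans (ler_sum _ (fun k _ => exp_term_le x k Td)))//.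
by rewrite -mulr_suml ler_wpM2r ?rnorm_ge0// series_exp_coeff_le// (proj1 Td).
Qed.

Lemma is_cvg_exp_partial T x : cvgn (fun N => exp_partial T N x).
Proof.
have [d Td] := bop_boundP T.
rewrite (_ : (fun N => _) =
    series (fun k : nat => (k`!%:R^-1 : R[i]) *: (T ^+ k) x)); last first.
  by apply/funext => N; rewrite exp_partialE.
apply: (@cvg_series_rnorm _ _ _ (rnorm x *: exp_coeff d)) => [k|].
  by rewrite [leRHS]mulrC exp_term_le.
exact/is_cvg_seriesZ/is_cvg_series_exp_coeff.
Qed.

(** Linearity passes to pointwise limits, and the bound [expR d] is uniform in [N]. This supplies
    the witness showing that [op_exp] is not its default value. *)
Lemma exp_limit_bounded_linear T :
  (fun x => limn (fun N => exp_partial T N x)) \in @bounded_linear R H H.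
Proof.
have cT x : exp_partial T N x @[N --> \oo] --> limn (fun N => exp_partial T N x).
  exact: is_cvg_exp_partial.
apply/asboolP; split.
  move=> a x y; apply: (@cvg_lim _ (@norm_hausdorff _ _)) => //.
  rewrite (_ : (fun N => _) =
      fun N => a *: exp_partial T N x + exp_partial T N y).
    by apply: cvgD; [apply: cvgZr|]; exact: cT.
  by apply/funext => N; rewrite bop_linP.
have [d Td] := bop_boundP T; exists (expR d)%:C => x.
rewrite !rnormE -rmorphM lecR; apply: rnorm_lim_le (cT x) _ => N.
exact: (proj2 (exp_partial_bound N Td)).
Qed.

(** The default branch of [xget] is refuted by the limit operator; afterwards [op_exp] is used only
    through this convergence. *)
Lemma op_expP T x : exp_partial T N x @[N --> \oo] --> op_exp T x.
Proof.
rewrite (_ : (fun N => _) =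
    series (fun k : nat => (k`!%:R^-1 : R[i]) *: (T ^+ k) x)); last first.
  by apply/funext => N; rewrite exp_partialE.
rewrite /op_exp.
case: xgetP => [B _|/(_ (Bop (exp_limit_bounded_linear T)))]; first exact.
case=> y /=; rewrite (_ : series _ = fun N => exp_partial T N y).
  exact: is_cvg_exp_partial.
by apply/funext => N; rewrite exp_partialE.
Qed.

Lemma op_exp_unique T x y : exp_partial T N x @[N --> \oo] --> y ->
  op_exp T x = y.
Proof. exact: (cvg_unique (@norm_hausdorff _ _)) (@op_expP T x). Qed.

Lemma op_exp_scalar (a : R) :
  op_exp (a%:C *: (1 : 'B(H))) = (expR a)%:C *: (1 : 'B(H)).
Proof.
have aX k x : ((a%:C *: (1 : 'B(H))) ^+ k) x = (a ^+ k)%:C *: x.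
  elim: k => [|k IH]; first by rewrite !expr0 scale1r.
  by rewrite !exprS bopME bopZE IH scalerA -rmorphM.
apply: bopPext => x; apply: op_exp_unique; apply/cvg_rnormP.
rewrite (_ : (fun N => _) =
    fun N => `|series (exp_coeff a) N - expR a| * rnorm x).
  rewrite -[0](mul0r (rnorm x)); apply: cvgMl; rewrite -[0](normr0 R).
  by apply: cvg_norm; apply/subr_cvg0; exact: cvg_series_exp_coeff.
apply/funext => N; rewrite -rnormZ; congr rnorm.
rewrite rmorphB/= scalerBl; congr (_ - _).
rewrite /exp_partial bop_sumE raddf_sum/= scaler_suml; apply: eq_bigr => k _.
transitivity ((k`!%:R^-1 : R[i]) *: ((a%:C *: (1 : 'B(H))) ^+ k) x) => //.
by rewrite aX scalerA factV_real -rmorphM mulrC.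
Qed.

(** The binomial theorem for commuting operators, divided by the factorial of [k]. *)
Lemma exp_convolution U V k : GRing.comm U V ->
  \sum_(0 <= i < k.+1)
    (i`!%:R^-1 * (k - i)`!%:R^-1 : R[i]) *: (U ^+ i * V ^+ (k - i)) =
  (k`!%:R^-1 : R[i]) *: (U + V) ^+ k.
Proof.
move=> UV; rewrite addrC exprDn_comm// big_mkord scaler_sumr.
apply: eq_bigr => i _.
have ik : (i <= k)%N by rewrite -ltnS.
have /(congr1 (fun n : nat => n%:R : R[i])) := bin_fact ik; rewrite !natrM => Ck.
rewrite -[_ * _ *+ _]scaler_nat scalerA -Ck (commrX _ (commr_sym (commrX _ UV))).
congr (_ *: _); field.
have := fact_gt0 i; have := fact_gt0 (k - i).
rewrite !pnatr_eq0 -!lt0n => -> ->.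
by rewrite bin_gt0.
Qed.

End OperatorExponential.

(** * The exponential of a sum of commuting operators *)

Section OperatorExponentialSum.
Context {R : realType} {H : hilbertType R}.
Implicit Types (S T U V : 'B(H)) (x y : H) (d : R).

Lemma exp_partialM U V N : GRing.comm U V ->
  exp_partial U N * exp_partial V N = exp_partial (U + V) N +
  \sum_(0 <= i < N) \sum_(0 <= j < N | (N <= i + j)%N)
    (i`!%:R^-1 * j`!%:R^-1 : R[i]) *: (U ^+ i * V ^+ j).
Proof.
move=> UV; transitivity (\sum_(0 <= i < N) \sum_(0 <= j < N)
    (i`!%:R^-1 * j`!%:R^-1 : R[i]) *: (U ^+ i * V ^+ j)).
  rewrite mulr_suml; apply: eq_bigr => i _; rewrite mulr_sumr.
  by apply: eq_bigr => j _; rewrite -bop_scaleAr -bop_scaleAl scalerA mulrC.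
rewrite (sum_square_split (fun i j =>
  (i`!%:R^-1 * j`!%:R^-1 : R[i]) *: (U ^+ i * V ^+ j))); congr (_ + _).
by apply: eq_bigr => k _; rewrite exp_convolution.
Qed.

Lemma exp_partialM_err U V d1 d2 N x : GRing.comm U V ->
  bop_bound U d1 -> bop_bound V d2 ->
  rnorm (exp_partial U N (exp_partial V N x) - exp_partial (U + V) N x) <=
  (\sum_(0 <= i < N) \sum_(0 <= j < N | (N <= i + j)%N)
    (i`!%:R^-1 * j`!%:R^-1) * (d1 ^+ i * d2 ^+ j)) * rnorm x.
Proof.
move=> UV Ud Vd; rewrite -bopME exp_partialM// bopDE addrC addKr bop_sumE.
rewrite (le_trans (ler_rnorm_sum _ _ _))// mulr_suml; apply: ler_sum => i _.
rewrite bop_sumE (le_trans (ler_rnorm_sum _ _ _))// mulr_suml.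
apply: ler_sum => j _; rewrite bopZE bopME !factV_real -rmorphM rnormZ.
rewrite ger0_norm ?mulr_ge0 ?invr_ge0// -!mulrA !ler_wpM2l ?invr_ge0//.
have [dU Ui] := bop_boundX i Ud; have [_ Vj] := bop_boundX j Vd.
by rewrite (le_trans (Ui _))// ler_wpM2l.
Qed.

(* The error made on partial sums is dominated, coefficient by coefficient, by
   the one made in [expR (d1 + d2) = expR d1 * expR d2]. *)
Lemma op_expD U V : GRing.comm U V -> op_exp (U + V) = op_exp U * op_exp V.
Proof.
move=> UV; apply: bopPext => x; apply: op_exp_unique; rewrite bopME.
have [d1 Ud] := bop_boundP U; have [d2 Vd] := bop_boundP V.
apply/cvg_rnormP.
pose a N := \sum_(0 <= i < N) \sum_(0 <= j < N | (N <= i + j)%N)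
  (i`!%:R^-1 * j`!%:R^-1) * (d1 ^+ i * d2 ^+ j).
pose b N := rnorm (exp_partial V N x - op_exp V x).
pose c N := rnorm (exp_partial U N (op_exp V x) - op_exp U (op_exp V x)).
have lim0 : a N * rnorm x + (expR d1 * b N + c N) @[N --> \oo] --> (0 : R).
  have a0 : a N @[N --> \oo] --> (0 : R) by exact: exp_tail_cvg0.
  have b0 : b N @[N --> \oo] --> (0 : R) by apply/cvg_rnormP; exact: op_expP.
  have c0 : c N @[N --> \oo] --> (0 : R) by apply/cvg_rnormP; exact: op_expP.
  have -> : 0 = 0 * rnorm x + (expR d1 * 0 + 0) :> R by rewrite mul0r mulr0 !addr0.
  by apply: cvgD; [exact: cvgMl|apply: cvgD => //; exact: cvgMr].
apply: squeeze_cvgr (cvg_cst 0) lim0; apply: nearW => N.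
rewrite rnorm_ge0/=.
have /(_ x) := exp_partialM_err N _ UV Ud Vd; rewrite -/(a N) rnormB => aN.
(* The triangle inequality goes through [exp_partial U N (exp_partial V N x)] and
   [exp_partial U N (op_exp V x)]. The middle difference is controlled because [exp_partial U N] is
   bounded by [expR d1] for all [N]. *)
apply: le_trans (_ : rnorm (_ + (exp_partial U N (exp_partial V N x - op_exp V x)
  + (exp_partial U N (op_exp V x) - op_exp U (op_exp V x)))) <= _); last first.
  apply: le_trans (ler_rnormD _ _) _; apply: (lerD aN).
  apply: le_trans (ler_rnormD _ _) _; rewrite lerD2r.
  exact: (proj2 (exp_partial_bound N Ud)).
by rewrite bop_linB !addrA !subrK.
Qed.

End OperatorExponentialSum.

(** * The operator order, powers and exponentials of positive operators *)

Lemma conjCc (R : rcfType) (z : R[i]) : Num.conj z = conjc z.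
Proof. by []. Qed.

Lemma conjCi (R : rcfType) : Num.conj ('i%C : R[i]) = - 'i%C.
Proof. by apply/eqP; rewrite eq_complex/= oppr0 !eqxx. Qed.

Lemma ReZ (R : rcfType) (a : R) (z : R[i]) :
  complex.Re (a%:C * z) = a * complex.Re z.
Proof. by case: z => x y /=; rewrite mul0r subr0. Qed.

Section OperatorOrder.
Context {R : realType} {H : hilbertType R}.
Implicit Types (S T U V X : 'B(H)) (x y : H) (c d : R).

Lemma op_ge0D S T : op_ge0 S -> op_ge0 T -> op_ge0 (S + T).
Proof. by move=> S0 T0 x; rewrite bopDE innerDl addr_ge0. Qed.

Lemma op_ge0Z c T : 0 <= c -> op_ge0 T -> op_ge0 (c%:C *: T).
Proof. by move=> c0 T0 x; rewrite bopZE innerZl mulr_ge0// ler0c. Qed.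

Lemma op_ge0_0 : op_ge0 (0 : 'B(H)).
Proof. by move=> x; rewrite (_ : (0 : 'B(H)) x = 0)// linear0l. Qed.

Lemma op_ge0_1 : op_ge0 (1 : 'B(H)).
Proof. by move=> x; exact: inner_ge0. Qed.

Lemma op_ge0_sum (I : Type) (r : seq I) (P : pred I) (F : I -> 'B(H)) :
  (forall i, P i -> op_ge0 (F i)) -> op_ge0 (\sum_(i <- r | P i) F i).
Proof.
by move=> F0; elim/big_ind: _ => //; [exact: op_ge0_0|exact: op_ge0D].
Qed.

Lemma op_le_trans S T U : op_le S T -> op_le T U -> op_le S U.
Proof. by move=> ST TU; rewrite /op_le -(subrK T U) -addrA; exact: op_ge0D. Qed.

(* Polarization: [<Az, z>] is real for [z = x + y] and for [z = x + iy]. *)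
Lemma op_ge0_selfadjoint T : op_ge0 T -> selfadjoint T.
Proof.
move=> T0 x y.
have realT z : complex.Im '[T z, z] = 0 by move: (T0 z); rewrite lecE => /andP[/eqP].
have := realT (x + y); have := realT (x + 'i%C *: y).
rewrite !bop_linD bop_linZ !innerDl !innerDr !innerZl !innerZr !raddfD/=.
rewrite conjCi.
rewrite (inner_conj x (T y)).
have := realT y; have := realT x.
case: '[T x, x] => x1 x2 /= ->; case: '[T y, y] => y1 y2 /= ->.
case: '[T x, y] => a b; case: '[T y, x] => a' b' /=.
rewrite conjCc /= => h1 h2; apply/eqP; rewrite eq_complex/=.
by apply/andP; split; apply/eqP; lra.
Qed.

Lemma selfadjoint_inner_real T x : selfadjoint T ->
  '[T x, x] = (complex.Re '[T x, x])%:C.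
Proof.
move=> sT; have := inner_conj (T x) x; rewrite -sT conjCc.
case: '[T x, x] => a b /= [/eqP]; rewrite -addr_eq0 -mulr2n mulrn_eq0/=.
by move=> /eqP ->.
Qed.

Lemma selfadjoint_ge0 T : selfadjoint T ->
  (forall x, 0 <= complex.Re '[T x, x]) -> op_ge0 T.
Proof. by move=> sT T0 x; rewrite selfadjoint_inner_real// ler0c. Qed.

Lemma selfadjointD S T : selfadjoint S -> selfadjoint T -> selfadjoint (S + T).
Proof. by move=> sS sT x y; rewrite !bopDE innerDl innerDr sS sT. Qed.

Lemma selfadjointZ c T : selfadjoint T -> selfadjoint (c%:C *: T).
Proof.
by move=> sT x y; rewrite !bopZE innerZl innerZr sT conjCc conjc_real.
Qed.

Lemma selfadjointN T : selfadjoint T -> selfadjoint (- T).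
Proof. by move=> sT x y; rewrite !bopNE linearNl linearNr/= sT. Qed.

Lemma selfadjointB S T : selfadjoint S -> selfadjoint T -> selfadjoint (S - T).
Proof. by move=> sS sT; apply: selfadjointD => //; exact: selfadjointN. Qed.

Lemma op_ge0_conj S T : selfadjoint S -> op_ge0 T -> op_ge0 (S * T * S).
Proof. by move=> sS T0 x; rewrite !bopME sS; exact: T0. Qed.

(** Induction by steps of two, writing [X ^+ k.+2] as [X * X ^+ k * X]; no square root is taken. *)
Lemma op_ge0X X k : op_ge0 X -> op_ge0 (X ^+ k).
Proof.
move=> X0; have sX := op_ge0_selfadjoint X0.
elim/ltn_ind: k => -[|[|k]] IH.
- by rewrite expr0; exact: op_ge0_1.
- by rewrite expr1.
- by rewrite exprS exprSr mulrA; apply: op_ge0_conj => //; exact: IH.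
Qed.

Lemma op_leX_step X k : op_ge0 X -> op_le X 1 -> op_le (X ^+ k.+1) (X ^+ k).
Proof.
move=> X0 X1; rewrite /op_le; have sX := op_ge0_selfadjoint X0.
have s1X := op_ge0_selfadjoint X1.
elim/ltn_ind: k => -[|[|k]] IH; first by rewrite expr1 expr0.
  (* Each summand is a positive operator conjugated by a self-adjoint one; since [X] and [1 - X]
     commute, the sum is [X * (1 - X) * (X + (1 - X))]. *)
  have -> : X ^+ 1 - X ^+ 2 = X * (1 - X) * X + (1 - X) * X * (1 - X).
    have XC : X * (1 - X) = (1 - X) * X.
      by rewrite mulrBl mulrBr mul1r mulr1.
    by rewrite -XC -mulrDr subrKC mulr1 mulrBr mulr1 expr1 expr2.
  by apply: op_ge0D; exact: op_ge0_conj.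
have -> : X ^+ k.+2 - X ^+ k.+3 = X * (X ^+ k - X ^+ k.+1) * X.
  by rewrite mulrBr mulrBl -!exprS -!exprSr.
by apply: op_ge0_conj => //; exact: IH.
Qed.

Lemma op_leX X k : op_ge0 X -> op_le X 1 -> op_le (X ^+ k.+1) X.
Proof.
move=> X0 X1; elim: k => [|k IH].
  by rewrite expr1 /op_le subrr; exact: op_ge0_0.
by apply: op_le_trans IH; exact: op_leX_step.
Qed.

(** Nonnegativity in [R[i]] includes being real. The imaginary part of ['[z, x]] is the real part of
    ['[z, 'i%C *: x]], so limits of real parts suffice. *)
Lemma inner_lim_ge0 (u : H^nat) l x : u @ \oo --> l ->
  (forall n, 0 <= '[u n, x]) -> 0 <= '[l, x].
Proof.
move=> ul u0; have ImE z : complex.Im '[z, x] = complex.Re '[z, 'i%C *: x].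
  rewrite innerZr conjCi.
  by case: '[z, x] => a b /=; lra.
rewrite lecE/=; apply/andP; split; last first.
  have ulx := inner_lim (x := x) ul; apply: (cvgr_to_ge ulx); apply: nearW => n.
  by have := u0 n; rewrite lecE => /andP[].
apply/eqP; rewrite ImE; apply: (cvg_unique _ (inner_lim (x := 'i%C *: x) ul)) => //.
rewrite (_ : (fun n => _) = fun=> 0); first exact: cvg_cst.
by apply/funext => n; rewrite -ImE; move: (u0 n); rewrite lecE => /andP[/eqP].
Qed.

Lemma op_exp_ge0 T : op_ge0 T -> op_ge0 (op_exp T).
Proof.
move=> T0 x; apply: inner_lim_ge0 (@op_expP _ _ T x) _ => N.
apply: op_ge0_sum => k _; rewrite factV_real; apply: op_ge0Z.
  by rewrite invr_ge0.
exact: op_ge0X.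
Qed.

Lemma bop_scaleX c T k : (c%:C *: T) ^+ k = (c ^+ k)%:C *: T ^+ k.
Proof.
elim: k => [|k IH]; first by rewrite !expr0 scale1r.
by rewrite !exprS IH -bop_scaleAl -bop_scaleAr scalerA -rmorphM.
Qed.

(** Operator form of the chord bound for the exponential on [0, c]: each power [X ^+ k.+1] in the
    series is replaced by [X], which is allowed since its coefficient is nonnegative. *)
Lemma op_exp_le_chord0 c X : 0 <= c -> op_ge0 X -> op_le X 1 ->
  op_le (op_exp (c%:C *: X)) (1 + (expR c - 1)%:C *: X).
Proof.
move=> c0 X0 X1.
suff pos N : op_le (exp_partial (c%:C *: X) N.+1) (1 + (expR c - 1)%:C *: X).
  move=> x; rewrite bopDE bopNE; apply: inner_lim_ge0 (fun N => pos N x).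
  apply: cvgB; first exact: cvg_cst.
  by have := @op_expP _ _ (c%:C *: X) x; rewrite -cvg_shiftS; exact.
pose t k := c ^+ k.+1 / k.+1`!%:R.
have eS : series (exp_coeff c) N.+1 = 1 + \sum_(0 <= k < N) t k.
  by rewrite series_exp_coeffE big_nat_recl//= expr0 fact0 divr1.
have tE : exp_partial (c%:C *: X) N.+1 = 1 + \sum_(0 <= k < N) (t k)%:C *: X ^+ k.+1.
  rewrite /exp_partial big_nat_recl//= expr0 fact0 invr1 scale1r; congr (_ + _).
  by apply: eq_bigr => k _; rewrite bop_scaleX scalerA factV_real -rmorphM mulrC.
(* The gap is the tail of the scalar series times [X], plus the termwise gaps [X - X ^+ k.+1]; all
   are positive. *)
rewrite /op_le (_ : _ - _ = (expR c - series (exp_coeff c) N.+1)%:C *: X +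
    \sum_(0 <= k < N) (t k)%:C *: (X - X ^+ k.+1)).
  apply: op_ge0D.
    by apply: op_ge0Z => //; rewrite subr_ge0 series_exp_coeff_le.
  apply: op_ge0_sum => k _; apply: op_ge0Z; last exact: op_leX.
  by rewrite divr_ge0// exprn_ge0.
under [in RHS]eq_bigr do rewrite scalerBr.
rewrite sumrB -scaler_suml -rmorph_sum addrA -scalerDl -rmorphD/= eS tE.
rewrite (_ : expR c - (1 + _) + _ = expR c - 1); last by rewrite opprD addrA subrK.
by rewrite opprD addrACA subrr add0r.
Qed.

Lemma op_exp_combination a b X : op_ge0 X -> op_le X 1 ->
  let W := op_exp (a%:C *: X + b%:C *: (1 - X)) in
  op_ge0 W /\ op_le W ((expR a)%:C *: X + (expR b)%:C *: (1 - X)).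
Proof.
(* Exchanging [X] with [1 - X] exchanges [a] with [b]. With [b <= a], the scalar factor [expR b]
   splits off and leaves the exponent [(a - b) X], whose coefficient is nonnegative. *)
wlog ba : a b X / b <= a => [wlg|].
  have [ba|/ltW ab] := leP b a; first exact: wlg.
  move=> X0 X1; have := wlg b a (1 - X) ab.
  rewrite /op_le !subKr [b%:C *: _ + _]addrC [(expR b)%:C *: _ + _]addrC; exact.
move=> X0 X1 /=.
have -> : a%:C *: X + b%:C *: (1 - X) = b%:C *: (1 : 'B(H)) + (a - b)%:C *: X.
  by rewrite scalerBr addrCA rmorphB/= scalerBl.
rewrite op_expD; last by apply: bop_commZ; exact/commr_sym/commr1.
have ab0 : 0 <= a - b by rewrite subr_ge0.
rewrite op_exp_scalar -bop_scaleAl mul1r; split.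
  by apply: op_ge0Z; [exact: expR_ge0|apply: op_exp_ge0; exact: op_ge0Z].
have := op_ge0Z (expR_ge0 b) (op_exp_le_chord0 ab0 X0 X1).
rewrite /op_le scalerBr scalerDr scalerA -rmorphM/= mulrBr mulr1 -expRD subrKC.
by rewrite scalerBr [in X in _ -> X]addrCA rmorphB/= scalerBl.
Qed.

End OperatorOrder.

(** * From the spectrum to operator inequalities *)

Section SpectralBounds.
Context {R : realType} {H : hilbertType R}.
Implicit Types (A B T : 'B(H)) (x : H) (t m : R).

Lemma op_le_scalarP A t : selfadjoint A ->
  op_le (t%:C *: (1 : 'B(H))) A <->
  forall x, t * rnorm x ^+ 2 <= complex.Re '[A x, x].
Proof.
move=> sA; have E x : '[(A - t%:C *: (1 : 'B(H))) x, x] =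
    (complex.Re '[A x, x] - t * rnorm x ^+ 2)%:C.
  rewrite bopDE bopNE bopZE innerBl innerZl innerxx selfadjoint_inner_real//=.
  by rewrite -rmorphM -rmorphB.
split=> [At x|At x]; last by rewrite E ler0c subr_ge0.
by have := At x; rewrite E ler0c subr_ge0.
Qed.

(* From [T^2 <= D T], one gets [|x|^2 <= C^2 |Tx|^2 <= C^2 D <Tx, x>]. *)
Lemma op_ge0_invertible_bound T B : op_ge0 T -> B * T = 1 ->
  exists2 e : R, 0 < e & op_le (e%:C *: (1 : 'B(H))) T.
Proof.
move=> T0 BT; have sT := op_ge0_selfadjoint T0.
have [d [d0 Td]] := bop_boundP T; have [c [c0 Bc]] := bop_boundP B.
(* The bounds [d] and [c] may be zero; the shift makes the constants invertible. *)
pose D := d + 1; pose C := c + 1.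
have D0 : 0 < D by rewrite /D; lra.
have C0 : 0 < C by rewrite /C; lra.
have X0 : op_ge0 (D^-1%:C *: T) by apply: op_ge0Z => //; rewrite invr_ge0 ltW.
have X1 : op_le (D^-1%:C *: T) 1.
  have sX := selfadjointZ D^-1 sT.
  apply: selfadjoint_ge0 => [|x]; first exact: selfadjointB.
  rewrite bopDE bopNE bopZE innerBl innerZl innerxx selfadjoint_inner_real//=.
  rewrite !mul0r !subr0 subr_ge0 mulrC ler_pdivrMr//.
  have /(le_trans (normc_ge_Re _)) := inner_norm_le (T x) x; rewrite lecR.
  move=> /(le_trans (ler_norm _)) /le_trans; apply.
  rewrite expr2 mulrC -mulrA ler_wpM2l ?rnorm_ge0// mulrC (le_trans (Td x))//.
  by rewrite ler_wpM2r ?rnorm_ge0// /D; lra.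
exists (C ^+ 2 * D)^-1; first by rewrite invr_gt0 mulr_gt0// exprn_gt0.
apply/op_le_scalarP => // x.
have := op_leX 1 X0 X1 x; rewrite bop_scaleX bopDE bopNE !bopZE innerBl !innerZl.
rewrite [T ^+ 2]expr2 bopME (sT (T x)) innerxx.
rewrite selfadjoint_inner_real// -!rmorphM -rmorphB ler0c subr_ge0 => TxD.
have xC : rnorm x <= C * rnorm (T x).
  have := Bc (T x); rewrite -bopME BT => /le_trans; apply.
  by rewrite ler_wpM2r ?rnorm_ge0// /C; lra.
have {}TxD : rnorm (T x) ^+ 2 <= D * complex.Re '[T x, x].
  move: TxD; rewrite expr2 -mulrA ler_pM2l ?invr_gt0// mulrC ler_pdivrMr//.
  by rewrite mulrC.
rewrite mulrC ler_pdivrMr ?mulr_gt0 ?exprn_gt0// mulrC -mulrA.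
apply: le_trans (ler_wpM2l (exprn_ge0 2 (ltW C0)) TxD).
by rewrite -exprMn ler_sqr ?nnegrE ?rnorm_ge0// mulr_ge0 ?rnorm_ge0// ltW.
Qed.

(* With [s] the largest real such that [s <= A], the operator [A - s] cannot be
   invertible, since it would then be bounded below by some [e > 0]. *)
Lemma spectrum_lower_bound A m : selfadjoint A ->
  (forall t, t < m -> ~ spectrum A t%:C) -> op_le (m%:C *: (1 : 'B(H))) A.
Proof.
move=> sA spA; apply/op_le_scalarP => // x0; rewrite leNgt; apply/negP => Ax0.
pose E : set R := [set t | op_le (t%:C *: (1 : 'B(H))) A].
have ltEm t : E t -> t < m.
  move=> /(op_le_scalarP t sA)/(_ x0) /le_lt_trans/(_ Ax0) tm.
  rewrite ltNge; apply/negP => mt; move: tm.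
  by rewrite ltNge ler_wpM2r// exprn_ge0// rnorm_ge0.
have [d [d0 Ad]] := bop_boundP A.
(* Cauchy-Schwarz bounds the quadratic form below by [- d], so [E] is nonempty. *)
have E0 : E (- d).
  apply/op_le_scalarP => // x; rewrite mulNr.
  have /(le_trans (normc_ge_Re _)) := inner_norm_le (A x) x; rewrite lecR.
  rewrite ler_norml => /andP[/(le_trans _) + _]; apply.
  by rewrite lerN2 expr2 mulrA ler_wpM2r ?rnorm_ge0.
have supE : has_sup E by split; [exists (- d)|exists m => t /ltEm/ltW].
(* The supremum is attained: for each nonzero [x], the Rayleigh quotient of [A] at [x] is an upper
   bound of [E]. *)
have Es : E (sup E).
  apply/op_le_scalarP => // x; have [->|x_neq0] := eqVneq x 0.
    by rewrite rnorm0 expr0n mulr0 linear0r.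
  have nx0 : 0 < rnorm x ^+ 2 by rewrite exprn_gt0// -ltcR -rnormE normr_gt0.
  rewrite -ler_pdivlMr//; apply: ge_sup; first exact: (proj1 supE).
  by move=> t /(op_le_scalarP t sA)/(_ x) tx; rewrite ler_pdivlMr.
have /contrapT[B [_ BA]] := spA _ (ltEm _ Es).
have [e e0 Ae] := op_ge0_invertible_bound Es BA.
have : E (sup E + e).
  by move: Ae; rewrite /E/= /op_le rmorphD/= scalerDl opprD addrA.
by move=> /(ub_le_sup (proj2 supE)); lra.
Qed.

(** The upper bound is the lower bound for [- A], whose spectrum is the reflected one. *)
Lemma spectrum_bounds A m M : selfadjoint A ->
  spectrum A `<=` [set t%:C | t in `[m, M]] ->
  op_le (m%:C *: (1 : 'B(H))) A /\ op_le A (M%:C *: (1 : 'B(H))).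
Proof.
move=> sA spA.
have specA t : spectrum A t%:C -> m <= t <= M.
  by move=> /spA[s /= + /complexI <-]; rewrite in_itv.
split.
  by apply: spectrum_lower_bound => // t tm /specA; rewrite leNgt tm.
have : op_le ((- M)%:C *: (1 : 'B(H))) (- A).
  apply: spectrum_lower_bound => [|t tM]; first exact: selfadjointN.
  move=> spNA; have : spectrum A (- t)%:C.
    move=> [B [AB BA]]; apply: spNA; exists (- B).
    have -> : - A - t%:C *: (1 : 'B(H)) = - (A - (- t)%:C *: (1 : 'B(H))).
      by rewrite rmorphN scaleNr opprK opprD.
    by rewrite !mulrNN.
  by move=> /specA; rewrite lerNl lerNr; lra.
by rewrite /op_le rmorphN/= scaleNr opprK addrC.
Qed.

End SpectralBounds.

(** * Integrals against spectral measures, and the exponential *)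

Section SpectralMeasure.
Context {R : realType} {m M : R}
  (mu : {finite_measure set (measurableTypeR R) -> \bar R}).
Implicit Types (a b t : R) (g : R -> R).

Lemma measurable_itvR : measurable (`[m, M] : set (measurableTypeR R)).
Proof. exact: measurable_itv. Qed.

Lemma itv_norm_le t : t \in `[m, M] -> `|t| <= `|m| + `|M|.
Proof.
rewrite in_itv/= ler_norml => /andP[mt tM]; apply/andP; split.
  by have := ler_norm (- m); have := normr_ge0 M; rewrite normrN; lra.
by have := ler_norm M; have := normr_ge0 m; lra.
Qed.

Lemma integrable_itv_bounded g c : measurable_fun `[m, M] g ->
  (forall t, t \in `[m, M] -> `|g t| <= c) ->
  mu.-integrable `[m, M] (EFin \o g).
Proof.
move=> mg gc; apply: (@le_integrable _ _ _ mu `[m, M] _ _ (EFin \o cst c)).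
- exact: measurable_itvR.
- exact/measurable_EFinP.
- by move=> t mtM /=; rewrite lee_fin (le_trans (gc t mtM))// ler_norm.
- by apply: finite_measure_integrable_cst; exact: measurable_itvR.
Qed.

Lemma integrable_itvX (k : nat) : mu.-integrable `[m, M] (EFin \o (fun t => t ^+ k)).
Proof.
apply: (@integrable_itv_bounded _ ((`|m| + `|M|) ^+ k)).
  exact: exprn_measurable.
move=> t mtM; rewrite normrX lerXn2r ?nnegrE ?addr_ge0//.
exact: itv_norm_le.
Qed.

Lemma integrable_itv_expR b :
  mu.-integrable `[m, M] (EFin \o (fun t => expR (b * t))).
Proof.
apply: (@integrable_itv_bounded _ (expR (`|b| * (`|m| + `|M|)))).
  apply: measurableT_comp; first exact: measurable_expR.
  by apply: measurable_funM => //; exact: measurable_cst.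
move=> t mtM; rewrite ger0_norm ?expR_ge0// ler_expR (le_trans (ler_norm _))//.
by rewrite normrM ler_wpM2l// itv_norm_le.
Qed.

Lemma integrable_itvZ c g : mu.-integrable `[m, M] (EFin \o g) ->
  mu.-integrable `[m, M] (EFin \o (fun t => c * g t)).
Proof. by move=> ig; exact: (integrableZl measurable_itvR c ig). Qed.

(** The two claims share one induction, as additivity of the integral requires the previous partial
    sum to be integrable. *)
Lemma integrable_exp_partial b N :
  mu.-integrable `[m, M] (EFin \o (fun t => series (exp_coeff (b * t)) N)) /\
  \int[mu]_(t in `[m, M]) series (exp_coeff (b * t)) N =
  \sum_(0 <= k < N) b ^+ k / k`!%:R * \int[mu]_(t in `[m, M]) (t ^+ k).
Proof.
elim: N => [|N [iN IH]].
  rewrite big_geq//.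
  have -> : (fun t => series (exp_coeff (b * t)) 0) = cst 0.
    by apply/funext => t; rewrite series_exp_coeffE big_geq.
  split; first by apply: finite_measure_integrable_cst; exact: measurable_itvR.
  by rewrite Rintegral_cst ?mul0r//; exact: measurable_itvR.
have -> : (fun t => series (exp_coeff (b * t)) N.+1) =
    (fun t => series (exp_coeff (b * t)) N + b ^+ N / N`!%:R * t ^+ N).
  apply/funext => t; rewrite !series_exp_coeffE big_nat_recr//=.
  by rewrite exprMn mulrAC.
have iX := integrable_itvZ (b ^+ N / N`!%:R) (integrable_itvX N).
split; first exact: (integrableD measurable_itvR iN iX).
rewrite (RintegralD measurable_itvR iN iX) IH.
rewrite (RintegralZl _ measurable_itvR (integrable_itvX N)).
by rewrite [RHS]big_nat_recr.
Qed.

(** Dominated convergence: on [m, M] every partial sum is at most the constant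
    [expR (|b| (|m| + |M|))] in absolute value, and constants are integrable for a finite
    measure. *)
Lemma cvg_integral_exp_partial b :
  \sum_(0 <= k < N) b ^+ k / k`!%:R * \int[mu]_(t in `[m, M]) (t ^+ k)
  @[N --> \oo] --> \int[mu]_(t in `[m, M]) expR (b * t).
Proof.
rewrite (_ : (fun N => _) =
  fun N => \int[mu]_(t in `[m, M]) series (exp_coeff (b * t)) N); last first.
  by apply/funext => N; rewrite (proj2 (integrable_exp_partial b N)).
apply: fine_cvg; rewrite fineK; last first.
  by apply: integrable_fin_num; [exact: measurable_itvR|exact: integrable_itv_expR].
apply: (@dominated_cvg _ _ _ mu `[m, M] _ _ _
  (EFin \o cst (expR (`|b| * (`|m| + `|M|))))) => //.
- move=> N; exact: measurable_int (proj1 (integrable_exp_partial b N)).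
- move=> t _; apply: cvg_EFin; first exact: nearW.
  exact: cvg_series_exp_coeff.
- by apply: finite_measure_integrable_cst; exact: measurable_itvR.
move=> N t mtM /=; rewrite lee_fin.
apply: le_trans (ler_norm_sum _ _ _) _.
apply: le_trans (_ : expR (`|b * t|) <= _).
  apply: le_trans (series_exp_coeff_le N (normr_ge0 _)).
  rewrite series_exp_coeffE; apply: ler_sum => k _.
  rewrite /exp_coeff/= normrM normrX normrV ?normr_nat//.
  by rewrite unitfE pnatr_eq0 -lt0n fact_gt0.
by rewrite ler_expR normrM ler_wpM2l// itv_norm_le.
Qed.

End SpectralMeasure.

Section FunctionalCalculus.
Context {R : realType} {H : hilbertType R}.
Implicit Types (A B : 'B(H)) (m M : R) (f : R -> R).

(** Both sides are limits of one sequence, the partial exponential sums evaluated through the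
    moments of [mu]. *)
Lemma spectral_measure_exp m M A x mu b : spectral_measure m M A x mu ->
  complex.Re '[op_exp (b%:C *: A) x, x] = \int[mu]_(t in `[m, M]) expR (b * t).
Proof.
move=> [_ momentE]; have h := inner_lim (x := x) (@op_expP _ _ (b%:C *: A) x).
apply: (cvg_unique _ h) => //.
rewrite (_ : (fun N => _) = fun N => \sum_(0 <= k < N) b ^+ k / k`!%:R *
    \int[mu]_(t in `[m, M]) (t ^+ k)); first exact: cvg_integral_exp_partial.
apply/funext => N; rewrite /exp_partial bop_sumE inner_suml raddf_sum/=.
apply: eq_bigr => k _; rewrite bop_scaleX scalerA factV_real -rmorphM.
rewrite [X in '[X, _]](_ : _ = (k`!%:R^-1 * b ^+ k)%:C *: (A ^+ k) x)//.
by rewrite innerZl momentE -rmorphM/= [_^-1 * _]mulrC.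
Qed.

End FunctionalCalculus.

(** * Log-convexity and chords, for scalars and then for operators *)

(** Here [w] is the barycentric coordinate, [t = (1 - w) m + w M]. Convexity of [ln f] gives the
    first bound, and convexity of [expR] turns it into the second. *)
Lemma log_convex_le (R : realType) (m M t : R) (f : R -> R) :
  m < M -> log_convex `[m, M] f -> t \in `[m, M] ->
  let w := (t - m) / (M - m) in
  f t <= expR ((1 - w) * ln (f m) + w * ln (f M)) /\
  f t <= (1 - w) * f m + w * f M.
Proof.
move=> mM [f0 cf] tmM w; have /andP[mt tM] : m <= t <= M by rewrite in_itv in tmM.
have Mm : 0 < M - m by rewrite subr_gt0.
have w0 : 0 <= w by rewrite divr_ge0// ?subr_ge0// ltW.
have w1 : w <= 1 by rewrite ler_pdivrMr// mul1r lerD2r.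
have fm0 : 0 < f m by apply: f0; rewrite /= in_itv/= lexx ltW.
have fM0 : 0 < f M by apply: f0; rewrite /= in_itv/= lexx ltW.
have ft : f t <= expR ((1 - w) * ln (f m) + w * ln (f M)).
  rewrite -[leLHS]lnK ?posrE ?f0// ler_expR.
  have mD : m \in `[m, M]%classic by rewrite inE/= in_itv/= lexx ltW.
  have MD : M \in `[m, M]%classic by rewrite inE/= in_itv/= lexx ltW.
  have := cf (Itv01 w0 w1) M m MD mD.
  have convE : w *: M + (1 - w) *: m = t.
    by rewrite /w /GRing.scale/=; field; rewrite gt_eqF.
  by rewrite convRE/= /unstable.onem [in X in _ <= X]addrC -[in X in _ -> X]convE.
split=> //; apply: (le_trans ft).
have := convex_expR (Itv01 w0 w1) (ln (f M)) (ln (f m)).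
by rewrite !convRE/= /unstable.onem !lnK ?posrE// addrC [in X in _ <= X]addrC.
Qed.

Section Chord.
Context {R : realType} (m M : R) (mM : m < M).
Implicit Types (H : hilbertType R) (f : R -> R).

Let Mm : 0 < M - m. Proof. by rewrite subr_gt0. Qed.

(** Operator counterpart of the barycentric coordinate: the affine map taking [m, M] to [0, 1],
    applied to [A]. *)
Definition op_frac H (A : 'B(H)) : 'B(H) :=
  (M - m)^-1%:C *: (A - m%:C *: (1 : 'B(H))).

Lemma op_fracC H (A : 'B(H)) :
  (M - m)^-1%:C *: (M%:C *: (1 : 'B(H)) - A) = 1 - op_frac A.
Proof.
transitivity ((M - m)^-1%:C *: ((M - m)%:C *: (1 : 'B(H))) - op_frac A).
  rewrite -scalerBr; congr (_ *: _).
  by rewrite rmorphB/= scalerBl opprB addrA subrK.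
by rewrite scalerA -rmorphM/= mulVf ?gt_eqF// scale1r.
Qed.

Lemma op_frac_ge0 H (A : 'B(H)) :
  op_le (m%:C *: (1 : 'B(H))) A -> op_ge0 (op_frac A).
Proof. by move=> mA; apply: op_ge0Z => //; rewrite invr_ge0 ltW. Qed.

Lemma op_frac_le1 H (A : 'B(H)) :
  op_le A (M%:C *: (1 : 'B(H))) -> op_le (op_frac A) 1.
Proof.
by move=> mA; rewrite /op_le -op_fracC; apply: op_ge0Z => //; rewrite invr_ge0 ltW.
Qed.

Lemma fcalcP f H (A : 'B(H)) :
  is_fcalc m M f A (fcalc m M f A) \/ fcalc m M f A = 0.
Proof. by rewrite /fcalc; case: xgetP => [B _ AB|_]; [left|right]. Qed.

Lemma fcalc_le_chord f H (A : 'B(H)) : log_convex `[m, M] f ->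
  selfadjoint A -> op_le (m%:C *: (1 : 'B(H))) A -> op_le A (M%:C *: (1 : 'B(H))) ->
  op_le (fcalc m M f A) ((f m)%:C *: (1 - op_frac A) + (f M)%:C *: op_frac A).
Proof.
move=> lcf sA mA AM; have [f0 _] := lcf.
have fm0 : 0 < f m by apply: f0; rewrite /= in_itv/= lexx ltW.
have fM0 : 0 < f M by apply: f0; rewrite /= in_itv/= lexx ltW.
(* For the default value [0], the bound says that the chord operator is positive, which holds since
   [f m] and [f M] are. *)
have [|->] := fcalcP f A; last first.
  rewrite /op_le subr0; apply: op_ge0D; apply: op_ge0Z; rewrite ?ltW//.
  - exact: op_frac_le1.
  - exact: op_frac_ge0.
move: (fcalc _ _ _ _) => B AB x; have [mu [[_ momentE] fi Bx]] := AB x.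
have := momentE 0; have := momentE 1; rewrite expr1 expr0 => Ax xx.
(* The chord is affine, so its quadratic form needs only the moments of order 0 and 1. *)
have Fx : '[op_frac A x, x] = ((M - m)^-1 * (\int[mu]_(t in `[m, M]) (t ^+ 1) -
    m * \int[mu]_(t in `[m, M]) (t ^+ 0)))%:C.
  rewrite bopZE innerZl bopDE bopNE bopZE innerBl innerZl Ax xx.
  by rewrite -!(rmorphM, rmorphB).
move: (op_frac A) Fx => F Fx.
rewrite bopDE bopNE innerBl Bx bopDE !bopZE bopDE bopNE innerDl !innerZl.
rewrite innerBl xx Fx -!(rmorphM, rmorphB, rmorphD)/= ler0c subr_ge0.
(* The chord of [f] is [p + q t]. *)
pose q := (f M - f m) / (M - m); pose p := f m - q * m.
have iD := measurable_itvR (m := m) (M := M).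
have i0 := integrable_itvX (m := m) (M := M) mu 0.
have i1 := integrable_itvX (m := m) (M := M) mu 1.
have ip := integrable_itvZ p i0; have iq := integrable_itvZ q i1.
rewrite [leRHS](_ : _ = \int[mu]_(t in `[m, M]) (p * t ^+ 0 + q * t ^+ 1)).
  apply: le_Rintegral => //; first exact: (integrableD iD ip iq).
  move=> t tmM; have [_ /le_trans] := log_convex_le mM lcf tmM; apply.
  rewrite expr0 expr1 /p /q le_eqVlt; apply/orP; left; apply/eqP.
  by field; rewrite gt_eqF.
rewrite (RintegralD iD ip iq) !RintegralZl//.
by rewrite /p /q; field; rewrite gt_eqF.
Qed.

Lemma fcalc_le_exp f H (A : 'B(H)) : log_convex `[m, M] f ->
  op_le (m%:C *: (1 : 'B(H))) A -> op_le A (M%:C *: (1 : 'B(H))) ->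
  op_le (fcalc m M f A)
    (op_exp ((ln (f m))%:C *: (1 - op_frac A) + (ln (f M))%:C *: op_frac A)).
Proof.
move=> lcf mA AM.
set a := ln (f m); set b := ln (f M).
(* Positivity of the exponential settles the default value [0], and also makes its quadratic form
   real. *)
have := op_exp_combination b a (op_frac_ge0 mA) (op_frac_le1 AM).
rewrite [_ *: op_frac A + _]addrC => -[P0 _].
have [|->] := fcalcP f A; last by rewrite /op_le subr0.
move: (fcalc _ _ _ _) => B AB x; have [mu [Amu fi Bx]] := AB x.
have sP := op_ge0_selfadjoint P0.
rewrite bopDE bopNE innerBl Bx selfadjoint_inner_real// -rmorphB ler0c subr_ge0.
(* Now [p + q t] interpolates [ln f] at [m] and [M]. The exponent becomes [p + q A], so the scalar
   [expR p] factors out and the moments of [A] determine the rest. *)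
pose q := (b - a) / (M - m); pose p := a - q * m.
have -> : a%:C *: (1 - op_frac A) + b%:C *: op_frac A =
    p%:C *: (1 : 'B(H)) + q%:C *: A.
  rewrite scalerBr -addrA -[- _ + _]addrC -scalerBl -rmorphB/= /op_frac.
  rewrite scalerA -rmorphM/= -/q scalerBr scalerA -rmorphM/= /p rmorphB/=.
  by rewrite scalerBl addrA addrAC.
rewrite op_expD; last by apply: bop_commZ; exact/commr_sym/commr1.
rewrite op_exp_scalar -bop_scaleAl mul1r bopZE innerZl.
rewrite ReZ (spectral_measure_exp q Amu).
have iD := measurable_itvR (m := m) (M := M).
have iq := integrable_itv_expR (m := m) (M := M) mu q.
rewrite -(RintegralZl _ iD iq); apply: le_Rintegral => //.
  exact: integrable_itvZ.
move=> t tmM; have [/le_trans + _] := log_convex_le mM lcf tmM; apply.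
rewrite -expRD ler_expR /p /q -/a -/b le_eqVlt; apply/orP; left; apply/eqP.
by field; rewrite gt_eqF.
Qed.

End Chord.

(** * Positive maps and the proof of the two inequalities *)

Lemma positive_map_le (R : realType) (H K : hilbertType R)
    (Phi : {linear 'B(H) -> 'B(K)}) (A B : 'B(H)) :
  positive_map Phi -> op_le A B -> op_le (Phi A) (Phi B).
Proof. by move=> Phi0 AB; rewrite /op_le -linearB; exact: Phi0. Qed.

Theorem theorem2p2 (R : realType) (H K : hilbertType R) (m M : R) (n : nat)
    (A : 'I_n -> 'B(H)) (Phi : 'I_n -> {linear 'B(H) -> 'B(K)}) (f : R -> R) :
  m < M ->
  (forall i, selfadjoint (A i)) ->
  (forall i, spectrum (A i) `<=` [set t%:C | t in `[m, M]]) ->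
  (forall i, positive_map (Phi i)) ->
  \sum_(i < n) Phi i 1 = 1 ->
  log_convex `[m, M] f ->
  let I : 'B(K) := 1 in
  let S : 'B(K) := \sum_(i < n) Phi i (A i) in
  let P : 'B(K) :=
    op_power (f m) ((M - m)^-1%:C *: (S - m%:C *: I)) *
    op_power (f M) ((M - m)^-1%:C *: (M%:C *: I - S)) in
  op_le (fcalc m M f ((M + m)%:C *: I - S)) P /\
  op_le P ((f M + f m)%:C *: I - \sum_(i < n) Phi i (fcalc m M f (A i))).
Proof.
move=> mM sA spA Phi0 Phi1 lcf I S P; have [f0 _] := lcf.
have fm0 : 0 < f m by apply: f0; rewrite /= in_itv/= lexx ltW.
have fM0 : 0 < f M by apply: f0; rewrite /= in_itv/= lexx ltW.
pose F := op_frac m M S.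
(* Since the maps sum to a unital one, the scalar bounds on the [A i] carry over to [S]. *)
have sumPhi1 (c : R) : \sum_(i < n) Phi i (c%:C *: (1 : 'B(H))) = c%:C *: I.
  by under eq_bigr do rewrite linearZ; rewrite -scaler_sumr Phi1.
have mS : op_le (m%:C *: I) S.
  rewrite -sumPhi1 /op_le -sumrB; apply: op_ge0_sum => i _.
  by apply: positive_map_le => //; exact: (proj1 (spectrum_bounds (sA i) (spA i))).
have SM : op_le S (M%:C *: I).
  rewrite -sumPhi1 /op_le -sumrB; apply: op_ge0_sum => i _.
  by apply: positive_map_le => //; exact: (proj2 (spectrum_bounds (sA i) (spA i))).
have F0 : op_ge0 F := op_frac_ge0 mM mS.
have F1 : op_le F 1 := op_frac_le1 mM SM.
(* The two powers merge into one exponential because [F] commutes with [1 - F]. *)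
have PE : P = op_exp ((ln (f m))%:C *: F + (ln (f M))%:C *: (1 - F)).
  rewrite /P /op_power op_fracC// -op_expD//; apply: bop_commZ.
  by rewrite /GRing.comm mulrBr mulrBl mulr1 mul1r.
have [_ PF] := op_exp_combination (ln (f m)) (ln (f M)) F0 F1.
rewrite PE; split.
  (* The reflection of [m, M] exchanges [F] and [1 - F], which matches the exponents of [P]. *)
  have EF : op_frac m M ((M + m)%:C *: I - S) = 1 - F.
    rewrite -op_fracC// /op_frac; congr (_ *: _).
    by rewrite rmorphD/= scalerDl addrAC addrK.
  have := @fcalc_le_exp _ m M mM f K ((M + m)%:C *: I - S) lcf.
  rewrite EF subKr; apply.
    by rewrite /op_le rmorphD/= scalerDl addrAC addrK.
  by rewrite /op_le rmorphD/= scalerDl opprB addrCA opprD addNKr.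
apply: op_le_trans PF _; rewrite !lnK ?posrE//.
have sumF : \sum_(i < n) Phi i (op_frac m M (A i)) = F.
  under eq_bigr do rewrite /op_frac linearZ linearB/=.
  by rewrite -scaler_sumr sumrB sumPhi1.
(* The chord bound for each [A i] is mapped by [Phi i] and summed; unitality collects the
   constants. *)
have : op_le (\sum_(i < n) Phi i (fcalc m M f (A i)))
    ((f m)%:C *: (I - F) + (f M)%:C *: F).
  rewrite -sumF /I -Phi1 -sumrB !scaler_sumr -big_split /op_le -sumrB.
  apply: op_ge0_sum => i _ /=.
  have [mAi AiM] := spectrum_bounds (sA i) (spA i).
  move: (op_frac m M (A i)) (fcalc_le_chord mM lcf (sA i) mAi AiM) => G FG.
  by rewrite -linearB -!linearZ -linearD; exact: (positive_map_le (Phi0 i) FG).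
rewrite /op_le; set Y := \sum_(i < n) _.
(* The upper bound for [P] and the chord bound for [Y] add up to [f M + f m], so the two gaps
   coincide. *)
suff -> : (f M + f m)%:C *: I - Y - ((f m)%:C *: F + (f M)%:C *: (1 - F)) =
  (f m)%:C *: (I - F) + (f M)%:C *: F - Y by [].
rewrite addrAC; congr (_ - _); apply/eqP; rewrite subr_eq addrACA -!scalerDr.
by rewrite subrK subrKC -scalerDl -rmorphD addrC.
Qed.
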